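(* Let $\mathbf C=(C_1,C_2)$ be the camera arrangement with $C_1=\begin{bmatrix}0 & I\end{bmatrix}$ and $C_2=\begin{bmatrix} I & 0\end{bmatrix}$, where $I$ is the $3\times 3$ identity matrix and $0$ is the zero column, and let $\mathcal C_{\mathbf C,2}\subseteq \mathbb P^5\times\mathbb P^5$ be its conic multiview variety. Then for $(\gamma,\delta)=\big((\gamma_0:\cdots:\gamma_5),(\delta_0:\cdots:\delta_5)\big)\in\mathbb P^5\times \mathbb P^5$ we have $(\gamma,\delta)\in \mathcal C_{\mathbf C,2}$ if and only if $$\mathrm{rank}\begin{bmatrix} \gamma_4^2-4\gamma_3\gamma_5 & \gamma_2\gamma_4-2\gamma_1\gamma_5 & \gamma_2^2-4\gamma_0\gamma_5\\ \delta_2^2-4\delta_0\delta_5 & \delta_1\delta_2-2\delta_0\delta_4 & \delta_1^2-4\delta_0\delta_3 \end{bmatrix}\le 1 .$$ Moreover, the ideal of $\mathbb C[\gamma_0,\dots,\gamma_5,\delta_0,\dots,\delta_5]$ generated by this rank condition (i.e. by the $2\times 2$ minors of the matrix) is the defining ideal of $\mathcal C_{\mathbf C,2}$.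
   Context: We work over $\mathbb C$. A camera is a full-rank matrix $C\in\mathbb C^{3\times 4}$, viewed as a rational map $\mathbb P^3\dashrightarrow \mathbb P^2$, $X\mapsto CX$; its center is $c=\ker C\in\mathbb P^3$. A camera arrangement is a tuple of cameras. Conics in $\mathbb P^2$ are identified with points $\gamma=(\gamma_0:\cdots:\gamma_5)\in\mathbb P^5$ via the curve $\gamma^\top \nu_2^2(x)=\gamma_0x_0^2+\gamma_1x_0x_1+\gamma_2x_0x_2+\gamma_3x_1^2+\gamma_4x_1x_2+\gamma_5x_2^2=0$, where $\nu_2^2(x)$ is the vector of all degree-2 monomials. For a $3\times 3$ matrix $A$, $\nu_2^{2,2}(A)$ is the $6\times 6$ matrix with $\nu_2^2(Ax)=\nu_2^{2,2}(A)\nu_2^2(x)$ for all $x$. For $h=(h_0:h_1:h_2:h_3)\in(\mathbb P^3)^*$ put $$H(h)=\begin{bmatrix}-h_1&-h_2&-h_3\\ h_0&0&0\\0&h_0&0\\0&0&h_0\end{bmatrix};$$ for $h_0\ne 0$ its image is the plane $\{X: h^\top X=0\}$. A pair $(h,\alpha)\in(\mathbb P^3)^*\times\mathbb P^5$ (with $h_0\neq 0$) represents the conic in $\mathbb P^3$ that is the image under $H(h)$ of the conic $\{x\in\mathbb P^2:\alpha^\top\nu_2^2(x)=0\}$. The joint camera map is the rational map $$\Phi_{\mathbf C,2}:(\mathbb P^3)^*\times\mathbb P^5\dashrightarrow \mathbb P^5\times\mathbb P^5,\qquad (h,\alpha)\mapsto\big(\nu_2^{2,2}(C_1H(h))^{-\top}\alpha,\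 \nu_2^{2,2}(C_2H(h))^{-\top}\alpha\big),$$ where $\bullet^{-\top}$ is the inverse transpose (defined where $C_iH(h)$ are invertible); it sends a space conic to its two image conics under $C_1,C_2$. The conic multiview variety $\mathcal C_{\mathbf C,2}$ is the Zariski closure of the image of $\Phi_{\mathbf C,2}$. The defining ideal of a subvariety of $\mathbb P^5\times\mathbb P^5$ is the ideal of all polynomials in $\mathbb C[\gamma,\delta]$ vanishing on it (equivalently, on its multi-affine cone in $\mathbb C^6\times\mathbb C^6$). *)

(* Defs.v *)
From HB Require Import structures.
From mathcomp Require Import all_boot all_order all_algebra.
From mathcomp Require Import classical_sets reals complex.
From mathcomp Require Import mpoly.
From mathcomp Require Import ring.

Set Implicit Arguments.
Unset Strict Implicit.
Unset Printing Implicit Defensive.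

Import GRing.Theory.
Local Open Scope classical_set_scope.
Local Open Scope ring_scope.

(* Points of projective spaces are given by nonzero column vectors of         *)
(* homogeneous coordinates. A subset of P^5 x P^5 is a set of pairs of        *)
(* nonzero vectors that is stable under rescaling each component.             *)

Definition proj_eq (K : fieldType) n (x y : 'cV[K]_n) : Prop :=
  exists2 k : K, k != 0 & x = k *: y.

Record camera (K : fieldType) := Camera {
  camera_mx :> 'M[K]_(3, 4);
  camera_full_rank : \rank camera_mx == 3 }.

(* The monomials x0^2, x0x1, x0x2, x1^2, x1x2, x2^2, as pairs of indices.     *)
Definition mon2 : 6.-tuple ('I_3 * 'I_3) :=
  [tuple (0, 0); (0, 1); (0, 2); (1, 1); (1, 2); (2, 2)].

Definition nu2 (K : comNzRingType) (x : 'cV[K]_3) : 'cV[K]_6 :=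
  \col_k (x (tnth mon2 k).1 0 * x (tnth mon2 k).2 0).

(* The (k, l) entry is the coefficient of the l-th monomial in the k-th       *)
(* monomial evaluated at A x; nu22P characterizes this matrix.                *)
Definition nu22 (K : comNzRingType) (A : 'M[K]_3) : 'M[K]_6 :=
  \matrix_(k, l)
    let: (i, j) := tnth mon2 k in
    let: (p, q) := tnth mon2 l in
    A i p * A j q + (if p == q then 0 else A i q * A j p).

Lemma nu22_mul (K : comNzRingType) (A : 'M[K]_3) (x : 'cV[K]_3) :
  nu2 (A *m x) = nu22 A *m nu2 x.
Proof.
apply/colP => k; rewrite !mxE.
case E: (tnth mon2 k) => [i j] /=.
rewrite [RHS](eq_bigr (fun l : 'I_6 =>
  (let: (p, q) := tnth mon2 l in
    A i p * A j q + (if p == q then 0 else A i q * A j p))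
  * (x (tnth mon2 l).1 0 * x (tnth mon2 l).2 0))); last first.
  by move=> l _; rewrite !mxE E.
rewrite !big_ord_recl !big_ord0 /=.
have -> : lift ord0 ord0 = 1 :> 'I_3 by apply: val_inj.
have -> : lift ord0 (lift ord0 ord0) = 2 :> 'I_3 by apply: val_inj.
have -> : ord0 = 0 :> 'I_3 by apply: val_inj.
ring.
Qed.

Lemma nu22P (K : comNzRingType) (A : 'M[K]_3) (M : 'M[K]_6) :
  (forall x : 'cV[K]_3, nu2 (A *m x) = M *m nu2 x) <-> M = nu22 A.
Proof.
split=> [HM | -> x]; last exact: nu22_mul.
have {}HM x : (M - nu22 A) *m nu2 x = 0.
  by rewrite mulmxBl -HM nu22_mul subrr.
apply/subr0_eq; move: (M - nu22 A : 'M_6) HM => N HN; apply/matrixP => k l.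
pose e (a b c : K) : 'cV[K]_3 := \col_i [:: a; b; c]`_i.
pose n (i : nat) := N k (inord i).
have nE i (h : (i < 6)%N) : N k (Ordinal h) = n i.
  by congr (N k _); apply: val_inj; rewrite /= ?inordK.
have ev a b c : n 0%N * (a * a) + n 1%N * (a * b) + n 2%N * (a * c)
    + n 3%N * (b * b) + n 4%N * (b * c) + n 5%N * (c * c) = 0.
  have /(congr1 (fun v : 'cV_6 => v k 0)) := HN (e a b c).
  rewrite !mxE !big_ord_recl big_ord0 !mxE /= addr0 !addrA => <-.
  by do ![congr (_ + _)]; congr (N k _ * _); apply: val_inj; rewrite /= ?inordK.
have h0 : n 0%N = 0 by rewrite -[RHS](ev 1 0 0); ring.
have h3 : n 3%N = 0 by rewrite -[RHS](ev 0 1 0); ring.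
have h5 : n 5%N = 0 by rewrite -[RHS](ev 0 0 1); ring.
have h1 : n 1%N = 0 by rewrite -[RHS](ev 1 1 0) h0 h3; ring.
have h2 : n 2%N = 0 by rewrite -[RHS](ev 1 0 1) h0 h5; ring.
have h4 : n 4%N = 0 by rewrite -[RHS](ev 0 1 1) h3 h5; ring.
rewrite [RHS]mxE.
by case: l => [[|[|[|[|[|[|//]]]]]] hl]; rewrite nE.
Qed.

(* For h 0 0 != 0 the column space of this matrix is the plane h^T X = 0.     *)
Definition plane_mx (K : fieldType) (h : 'cV[K]_4) : 'M[K]_(4, 3) :=
  col_mx (\row_(j < 3) - h (lift ord0 j) 0) (h 0 0)%:M.

Definition camera_conic (K : fieldType) (C : camera K)
    (h : 'cV[K]_4) (alpha : 'cV[K]_6) : 'cV[K]_6 :=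
  (invmx (nu22 (C *m plane_mx h)))^T *m alpha.

(* The image of the partial map (h, alpha) |-> (camera_conic C1 h alpha,       *)
(* camera_conic C2 h alpha), taken where both C1 *m plane_mx h and            *)
(* C2 *m plane_mx h are invertible.                                           *)
(* Invertibility of C *m plane_mx h forces h 0 0 != 0.                        *)
Definition joint_image (K : fieldType) (C1 C2 : camera K) :
    set ('cV[K]_6 * 'cV[K]_6) :=
  [set p | exists (h : 'cV[K]_4) (alpha : 'cV[K]_6),
    [/\ h != 0, alpha != 0,
        C1 *m plane_mx h \in unitmx & C2 *m plane_mx h \in unitmx] /\
    (proj_eq p.1 (camera_conic C1 h alpha) /\
     proj_eq p.2 (camera_conic C2 h alpha))].

(* In {mpoly K[6 + 6]} the first six variables are the coordinates of the     *)
(* first factor of P^5 x P^5 and the last six those of the second factor.     *)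
Definition bieval (K : fieldType) (f : {mpoly K[6 + 6]})
    (p : 'cV[K]_6 * 'cV[K]_6) : K :=
  f.@[fun i => col_mx p.1 p.2 i 0].

Definition bihomogeneous (K : fieldType) (f : {mpoly K[6 + 6]}) : Prop :=
  exists d e : nat, forall m, m \in msupp f ->
    (\sum_(i < 6) m (lshift 6 i) = d)%N /\ (\sum_(i < 6) m (rshift 6 i) = e)%N.

Definition zero_locus (K : fieldType) (F : set {mpoly K[6 + 6]}) :
    set ('cV[K]_6 * 'cV[K]_6) :=
  [set p | [/\ p.1 != 0, p.2 != 0 & forall f, F f -> bieval f p = 0]].

Definition zariski_closed (K : fieldType) (Z : set ('cV[K]_6 * 'cV[K]_6)) :
    Prop :=
  exists2 F : set {mpoly K[6 + 6]},
    F `<=` @bihomogeneous K & Z = zero_locus F.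

Definition zariski_closure (K : fieldType) (S : set ('cV[K]_6 * 'cV[K]_6)) :
    set ('cV[K]_6 * 'cV[K]_6) :=
  [set p | forall Z, zariski_closed Z -> S `<=` Z -> Z p].

Definition conic_multiview (K : fieldType) (C1 C2 : camera K) :
    set ('cV[K]_6 * 'cV[K]_6) :=
  zariski_closure (joint_image C1 C2).

Definition defining_ideal (K : fieldType) (S : set ('cV[K]_6 * 'cV[K]_6)) :
    set {mpoly K[6 + 6]} :=
  [set f | forall p, S p -> bieval f p = 0].

Lemma camera1_rank (K : fieldType) :
  \rank (row_mx (0 : 'cV[K]_3) 1%:M : 'M[K]_(3, 1 + 3)) == 3.
Proof.
by apply/row_freeP; exists (col_mx 0 1%:M); rewrite mul_row_col mul0mx add0r mul1mx.
Qed.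

Lemma camera2_rank (K : fieldType) :
  \rank (row_mx 1%:M (0 : 'cV[K]_3) : 'M[K]_(3, 3 + 1)) == 3.
Proof.
by apply/row_freeP; exists (col_mx 1%:M 0); rewrite mul_row_col mul0mx addr0 mul1mx.
Qed.

Definition camera1 (K : fieldType) : camera K := Camera (camera1_rank K).
Definition camera2 (K : fieldType) : camera K := Camera (camera2_rank K).

(* Stated over a ring, so as to apply both to coordinates of points and to    *)
(* the variables of the polynomial ring.                                      *)
Definition tangency_mx (A : comNzRingType) (g d : 'cV[A]_6) : 'M[A]_(2, 3) :=
  \matrix_(i, j) nth 0 (nth [::]
    [:: [:: g 4 0 ^+ 2 - 4 * g 3 0 * g 5 0;
            g 2 0 * g 4 0 - 2 * g 1 0 * g 5 0;
            g 2 0 ^+ 2 - 4 * g 0 0 * g 5 0];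
        [:: d 2 0 ^+ 2 - 4 * d 0 0 * d 5 0;
            d 1 0 * d 2 0 - 2 * d 0 0 * d 4 0;
            d 1 0 ^+ 2 - 4 * d 0 0 * d 3 0]] i) j.

Definition gamma_vars (K : fieldType) : 'cV[{mpoly K[6 + 6]}]_6 :=
  \col_i 'X_(lshift 6 i).
Definition delta_vars (K : fieldType) : 'cV[{mpoly K[6 + 6]}]_6 :=
  \col_i 'X_(rshift 6 i).

Definition ideal_generated (A : comNzRingType) (I : finType) (g : I -> A) :
    set A :=
  [set f | exists a : I -> A, f = \sum_i a i * g i].

(* Indexed by all pairs of columns; repeated columns give 0 and a swap only   *)
(* changes the sign.                                                          *)
Definition minor2 (A : comNzRingType) n (M : 'M[A]_(2, n))
    (s : {ffun 'I_2 -> 'I_n}) : A :=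
  \det (colsub s M).

(* Main.v *)
Require Import Defs.
From HB Require Import structures.
From mathcomp Require Import all_boot all_order all_algebra.
From mathcomp Require Import classical_sets reals complex.
From mathcomp Require Import mpoly.
From mathcomp Require Import ring.

Set Implicit Arguments.
Unset Strict Implicit.
Unset Printing Implicit Defensive.

Import GRing.Theory Num.Theory.
Local Open Scope ring_scope.

(** The plane curve with equation gamma has a discriminant with respect to x2,
    a binary quadratic form in (x0, x1) whose zeros are the tangent lines to
    the curve through the point (0 : 0 : 1), the image of the second camera
    center under the first camera. In the same way the discriminant of delta
    with respect to its first variable describes the tangent lines through
    (1 : 0 : 0), the image of the first center. Both pencils of lines are the
    pencil of planes through the two centers, with the same parameter, and the
    tangent lines of both image curves come from the planes of the pencil that
    are tangent to the space conic. So the two binary forms are proportional,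
    and this proportionality is the rank condition. In coordinates, the first
    camera is the identity on the chart of a plane and the second one is
    x |-> (u . x, s x0, s x1), so that gamma is a multiple of the pullback of
    delta along this substitution (joint_image_pullback); completing squares
    shows that conversely a pair with gamma5, delta0 nonzero and discriminants
    proportional by a nonzero square is in the image
    (discriminant_joint_image).

    Both parts of the theorem follow from one algebraic fact: a polynomial f
    that vanishes on the image belongs to the ideal I of the 2 x 2 minors
    (vanishing_ideal_generated). Write q11, q01, q00 for the entries of the
    first row, for gamma, and q11', q01', q00' for those of the second one.
    Its proof has two halves.

    - Where q11 delta0 does not vanish, the minors determine delta4 and delta3
      in terms of the other variables. Hence some power of q11 delta0, times f,
      is congruent modulo I to a polynomial without delta3 and delta4
      (elim_two). Over an algebraically closed field a generic choice of the
      other ten coordinates extends to a point of the image, so this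
      polynomial is 0 and a power of q11 delta0, times f, lies in I
      (vanishing_in_minors).

    - Multiplication by q11 delta0 is injective modulo I. Modulo gamma5 the
      first row becomes (x^2, xy, y^2) with x = gamma4 and y = gamma2; the
      relations between the minors of the matrix with this first row are
      generated by its two rows, as in the Hilbert-Burch theorem, so they lift
      to relations between the original minors, and gamma5 can be cancelled
      modulo I (syzygy_square_row, regular_square_row). The same holds for
      delta0. For q11, a relation q11 f = v0 m0 + v1 m1 + v2 m2 is simplified
      by pseudo-division with respect to gamma3, delta5 and gamma1, in which
      q11, q11' and q01 are linear; the leading coefficients are multiples of
      gamma5 and delta0, which are already known to cancel (regular_entry). *)

(** * Polynomials and polynomial functions *)

Lemma mpoly_ring_ind (R : comNzRingType) n (P : {mpoly R[n]} -> Prop) :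
    (forall c, P c%:MP) -> (forall i, P 'X_i) ->
    (forall p q, P p -> P q -> P (p + q)) ->
    (forall p q, P p -> P q -> P (p * q)) ->
  forall p, P p.
Proof.
move=> PC PX PD PM p; rewrite [p]mpolyE.
apply: big_ind => [|q r|m _]; [by rewrite -mpolyC0|exact: PD|].
rewrite -mul_mpolyC mpolyXE_id; apply: (PM) => //.
apply: big_ind => [|q r|i _]; [by rewrite -mpolyC1|exact: PM|].
elim: (m i) => [|k IHk]; first by rewrite expr0 -mpolyC1.
by rewrite exprS; apply: PM.
Qed.

Lemma muni_eq0 (R : comNzRingType) n (p : {mpoly R[n.+1]}) :
  muni p = 0 -> p = 0.
Proof.
suff Ep : p = (mpwiden (muni p)).['X_ord_max].
  by move=> p0; rewrite Ep p0 rmorph0 horner0.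
elim/mpoly_ring_ind: p => [c|i|p q Ep Eq|p q Ep Eq].
- by rewrite muniC mpwidenC hornerC /= mwidenC.
- rewrite /muni mmapX mmap1U; case: splitP => j /= ji.
    rewrite mpwidenC hornerC /= mwidenX mnmwiden1.
    by congr 'X_[ U_( _ )]; apply: val_inj.
  rewrite mpwidenX hornerX.
  by congr 'X_[ U_( _ )]; apply: val_inj; rewrite /= ji ord1 addn0.
- by rewrite {1}Ep {1}Eq muniD rmorphD /= hornerD.
- by rewrite {1}Ep {1}Eq muniM rmorphM /= hornerM.
Qed.

Lemma meval_muni (R : comNzRingType) n (p : {mpoly R[n.+1]}) v c :
  (map_poly (meval v) (muni p)).[c]
  = p.@[fun i => if unlift ord_max i is Some j then v j else c].
Proof.
elim/mpoly_ring_ind: p => [d|i|p q IHp IHq|p q IHp IHq].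
- by rewrite muniC map_polyC hornerC /= !mevalC.
- rewrite /muni mmapX mmap1U mevalXU; case: splitP => j /= ji.
    rewrite map_polyC hornerC /= mevalXU.
    have -> : i = lift ord_max j.
      by apply: val_inj; rewrite [LHS]ji [RHS]lift_max.
    by rewrite liftK.
  rewrite map_polyX hornerX.
  have -> : i = ord_max by apply: val_inj; rewrite /= ji ord1 addn0.
  by rewrite unlift_none.
- by rewrite mevalD -IHp -IHq muniD rmorphD hornerD.
- by rewrite mevalM -IHp -IHq muniM rmorphM hornerM.
Qed.

Lemma poly_fun_eq0 (K : numFieldType) (p : {poly K}) :
  (forall x, p.[x] = 0) -> p = 0.
Proof.
move=> p0; apply: (@roots_geq_poly_eq0 _ _ [seq k%:R | k <- iota 0 (size p)]).
- by apply/allP => x _; rewrite /root p0.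
- by rewrite map_inj_uniq ?iota_uniq // => k l /eqP; rewrite eqr_nat => /eqP.
- by rewrite size_map size_iota.
Qed.

(** Induction on the number of variables: for fixed values of the other
    variables, a polynomial in the last one vanishes identically, so its
    coefficients vanish at all values of the other variables. *)
Lemma mpoly_fun_eq0 (K : numFieldType) n (p : {mpoly K[n]}) :
  (forall v, p.@[v] = 0) -> p = 0.
Proof.
elim: n p => [|n IHn] p p0.
  have Ep : p = (p.@[fun=> 0])%:MP.
    elim/mpoly_ring_ind: p {p0} => [c|[]//|p q Ep Eq|p q Ep Eq].
    - by rewrite mevalC.
    - by rewrite mevalD mpolyCD -Ep -Eq.
    - by rewrite mevalM mpolyCM -Ep -Eq.
  by rewrite Ep p0 mpolyC0.
apply: muni_eq0; apply/polyP => k; rewrite coef0; apply: IHn => v.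
have E : map_poly (meval v) (muni p) = 0.
  by apply: poly_fun_eq0 => c; rewrite meval_muni p0.
by rewrite -[LHS](coef_map (meval v)) /= E coef0.
Qed.

(** * Divisibility and ideals of minors *)

Definition dvdr (A : comNzRingType) (q p : A) := exists r, p = r * q.

(** Multiplication by h is injective on the quotient by the ideal I. *)
Definition regular_mod (A : comNzRingType) (I : A -> Prop) (h : A) :=
  forall f, I (h * f) -> I f.

Section Regular.
Variables (A : comNzRingType) (I : A -> Prop).

Lemma regularM h k :
  regular_mod I h -> regular_mod I k -> regular_mod I (h * k).
Proof. by move=> hh hk f; rewrite -mulrA => /hh /hk. Qed.

Lemma regularX h N : regular_mod I h -> regular_mod I (h ^+ N).
Proof.
move=> hh; elim: N => [|N IHN]; first by move=> f; rewrite expr0 mul1r.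
by rewrite exprS; apply: regularM.
Qed.

Lemma regular_inv h k :
  (forall r f, I f -> I (r * f)) -> k * h = 1 -> regular_mod I h.
Proof. by move=> IM kh f /(IM k); rewrite mulrA kh mul1r. Qed.

End Regular.

(** The ideal of 2 x 2 minors of the matrix with rows (a, b, c) and
    (a', b', c'); the generators are the coordinates of the cross product of
    the rows, so that both rows are syzygies. *)
Definition in_minors (A : comNzRingType) (a b c a' b' c' f : A) :=
  exists v : A * A * A,
    f = v.1.1 * (b * c' - c * b') + v.1.2 * (c * a' - a * c')
        + v.2 * (a * b' - b * a').

Section Minors.
Variables (A : comNzRingType) (a b c a' b' c' : A).
Local Notation I := (in_minors a b c a' b' c').

Lemma in_minorsM r f : I f -> I (r * f).
Proof.
by move=> [v ->]; exists (r * v.1.1, r * v.1.2, r * v.2) => /=; ring.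
Qed.

Lemma in_minorsD f g : I f -> I g -> I (f + g).
Proof.
move=> [u ->] [v ->].
by exists (u.1.1 + v.1.1, u.1.2 + v.1.2, u.2 + v.2) => /=; ring.
Qed.

Lemma in_minors_swap f : I f <-> in_minors a' b' c' a b c f.
Proof. by split=> -[v ->]; exists (- v.1.1, - v.1.2, - v.2) => /=; ring. Qed.

End Minors.

(** * Pseudo-division by a polynomial that is linear in a variable *)

Section Elimination.
Variables (K : numFieldType) (n : nat).
Local Notation S := {mpoly K[n]}.
Implicit Types (p q f g h v : S) (i j : 'I_n).

(** Setting the variable of index i to 0. The condition kill i p = p says that
    this variable does not occur in p. *)
Definition kill i : S -> S :=
  comp_mpoly [tuple (if j == i then 0 else 'X_j) | j < n].

HB.instance Definition _ i := GRing.RMorphism.copy (kill i)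
  (comp_mpoly [tuple (if j == i then 0 else 'X_j) | j < n]).

Lemma killX i j : kill i 'X_j = if j == i then 0 else 'X_j.
Proof. by rewrite /kill comp_mpolyXU -tnth_nth tnth_mktuple. Qed.

Lemma killC i c : kill i c%:MP = c%:MP.
Proof. exact: comp_mpolyC. Qed.

Lemma kill0 i : kill i 0 = 0.
Proof. exact: rmorph0. Qed.

Lemma kill_mod i p : exists q, p = kill i p + q * 'X_i.
Proof.
elim/mpoly_ring_ind: p => [c|j|p q [p' Ep] [q' Eq]|p q [p' Ep] [q' Eq]].
- by exists 0; rewrite killC mul0r addr0.
- rewrite killX; case: eqP => [->|_]; first by exists 1; rewrite add0r mul1r.
  by exists 0; rewrite mul0r addr0.
- by exists (p' + q'); rewrite rmorphD /= {1}Ep {1}Eq; ring.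
- exists (p' * kill i q + q' * kill i p + p' * q' * 'X_i).
  by rewrite rmorphM /= {1}Ep {1}Eq; ring.
Qed.

Lemma meval_kill i p w :
  (kill i p).@[w] = p.@[fun j => if j == i then 0 else w j].
Proof.
rewrite /kill comp_mpoly_meval; apply: meval_eq => j.
by rewrite tnth_mktuple; case: eqP => _; rewrite ?meval0 ?mevalXU.
Qed.

Definition upd i (x : K) (w : 'I_n -> K) j := if j == i then x else w j.

Lemma meval_free i p x w : kill i p = p -> p.@[upd i x w] = p.@[w].
Proof.
move=> <-; rewrite !meval_kill; apply: meval_eq => j.
by rewrite /upd; case: eqP.
Qed.

Lemma kill_comm i j p : kill j (kill i p) = kill i (kill j p).
Proof.
elim/mpoly_ring_ind: p => [c|k|p q IHp IHq|p q IHp IHq].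
- by rewrite !killC.
- rewrite !killX; case: ifP => ki; case: ifP => kj;
    by rewrite ?killX ?ki ?kj ?kill0.
- by rewrite !rmorphD /= IHp IHq.
- by rewrite !rmorphM /= IHp IHq.
Qed.

Lemma kill_idem i p : kill i (kill i p) = kill i p.
Proof.
elim/mpoly_ring_ind: p => [c|k|p q IHp IHq|p q IHp IHq].
- by rewrite !killC.
- by rewrite !killX; case: ifP => ki; rewrite ?killX ?ki ?kill0.
- by rewrite !rmorphD /= IHp IHq.
- by rewrite !rmorphM /= IHp IHq.
Qed.

(** Pseudo-division: h ^+ N allows to replace the variable by v / h. The
    statement for all large N allows to treat several polynomials with a common
    exponent. *)
Lemma elim_var i h v f : kill i h = h -> kill i v = v ->
  exists N0, forall N, (N0 <= N)%N ->
    exists2 g, kill i g = g & dvdr (h * 'X_i - v) (h ^+ N * f - g).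
Proof.
move=> hi vi.
elim/mpoly_ring_ind: f => [c|j|p q [M IHp] [N IHq]|p q [M IHp] [N IHq]].
- exists 0%N => N _; exists (h ^+ N * c%:MP).
    by rewrite rmorphM rmorphXn /= killC hi.
  by exists 0; ring.
- have [->|ji] := eqVneq j i; last first.
    exists 0%N => N _; exists (h ^+ N * 'X_j).
      by rewrite rmorphM rmorphXn /= killX (negbTE ji) hi.
    by exists 0; ring.
  exists 1%N => -[|N] // _; exists (h ^+ N * v).
    by rewrite rmorphM rmorphXn /= vi hi.
  by exists (h ^+ N); rewrite exprS; ring.
- exists (M + N)%N => k Mk.
  have [g gi [r Eg]] := IHp k (leq_trans (leq_addr _ _) Mk).
  have [g' gi' [r' Eg']] := IHq k (leq_trans (leq_addl _ _) Mk).
  exists (g + g'); first by rewrite rmorphD /= gi gi'.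
  by exists (r + r'); rewrite mulrDl -Eg -Eg'; ring.
- exists (M + N)%N => k Mk.
  have [g gi [r Eg]] := IHp M (leqnn _).
  have Nk : (N <= k - M)%N by rewrite leq_subRL ?(leq_trans _ Mk) ?leq_addr.
  have [g' gi' [r' Eg']] := IHq _ Nk.
  exists (g * g'); first by rewrite rmorphM /= gi gi'.
  exists (r * h ^+ (k - M) * q + g * r').
  have -> : h ^+ k = h ^+ M * h ^+ (k - M).
    by rewrite -exprD subnKC ?(leq_trans _ Mk) ?leq_addr.
  have -> : h ^+ M * (h ^+ (k - M)) * (p * q) - g * g'
     = (h ^+ M * p - g) * h ^+ (k - M) * q + g * (h ^+ (k - M) * q - g').
    by ring.
  by rewrite Eg' Eg; ring.
Qed.

(** At a point where h is nonzero, the value of g does not change when the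
    coordinate of index i is moved to v / h, where the divisor vanishes. *)
Lemma free_multiple_eq0 i h v g :
  kill i h = h -> kill i v = v -> h != 0 -> kill i g = g ->
  dvdr (h * 'X_i - v) g -> g = 0.
Proof.
move=> hi vi h0 gi [r Eg]; apply/eqP.
have /eqP : h * g = 0.
  apply: mpoly_fun_eq0 => w; rewrite mevalM.
  have [->|hw] := eqVneq h.@[w] 0; first by rewrite mul0r.
  rewrite -(meval_free (v.@[w] / h.@[w]) w gi) Eg mevalM mevalB mevalM mevalXU.
  rewrite (meval_free _ _ hi) (meval_free _ _ vi) /upd eqxx.
  by rewrite (mulrC h.@[w] (_ / _)) divfK // subrr !mulr0.
by rewrite mulf_eq0 (negbTE h0).
Qed.

(** The divisor is irreducible up to factors of h: the remainder g in the
    pseudo-division of f is 0 because P * g is free of the variable and is still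
    a multiple of the divisor. *)
Lemma gauss_linear i h v P f :
  kill i h = h -> kill i v = v -> h != 0 -> kill i P = P -> P != 0 ->
  dvdr (h * 'X_i - v) (P * f) -> exists N, dvdr (h * 'X_i - v) (h ^+ N * f).
Proof.
move=> hi vi h0 Pi P0 [r Er].
have [N /(_ N (leqnn _)) [g gi [s Es]]] := elim_var f hi vi.
exists N; suff g0 : g = 0 by exists s; rewrite -Es g0 subr0.
have /eqP : P * g = 0.
  apply: (free_multiple_eq0 hi vi h0); first by rewrite rmorphM /= gi Pi.
  exists (h ^+ N * r - P * s).
  have -> : P * g = h ^+ N * (P * f) - P * (h ^+ N * f - g) by ring.
  by rewrite Er Es; ring.
by rewrite mulf_eq0 (negbTE P0) => /eqP.
Qed.

Lemma kill_eq0 i p : kill i p = 0 -> dvdr 'X_i p.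
Proof.
by have [q Eq] := kill_mod i p; move=> p0; exists q; rewrite {1}Eq p0 add0r.
Qed.

(** Variables are prime elements. *)
Lemma gaussX i p q : kill i p != 0 -> dvdr 'X_i (p * q) -> dvdr 'X_i q.
Proof.
move=> p0 [r /(congr1 (kill i))]; rewrite !rmorphM /= killX eqxx mulr0 => /eqP.
by rewrite mulf_eq0 (negbTE p0) => /eqP /kill_eq0.
Qed.

Lemma mpolyX_neq0 i : 'X_i != 0 :> S.
Proof.
apply/eqP => Xi0; have := mevalXU (fun=> 1 : K) i.
by rewrite Xi0 meval0 => /esym/eqP; rewrite oner_eq0.
Qed.

Lemma dvdr_cancelX i q f : kill i q != 0 -> dvdr q ('X_i * f) -> dvdr q f.
Proof.
move=> q0 [r Er].
have [|s Es] := @gaussX i q r q0; first by exists f; rewrite mulrC -Er mulrC.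
exists s; apply: (mulfI (mpolyX_neq0 i)); rewrite Er Es; ring.
Qed.

End Elimination.

(** * Regular elements modulo the minors *)

(** Reduces an equation that follows linearly from two others to an identity
    of commutative rings. *)
Lemma eq_comb (A : comNzRingType) (k l r l' r' x y : A) :
  l = r -> l' = r' -> x - y = k * (l - r) + (l' - r') -> x = y.
Proof. by move=> -> ->; rewrite !subrr mulr0 add0r => /subr0_eq. Qed.

(** The minors are, up to sign, y P, x P + y Q and x Q, where P = x c - y b and
    Q = x b - y a. A relation between them is a relation between P and Q, and
    the coprimality of P and Q, then that of x and y, reduces it to a
    combination of the rows (x^2, xy, y^2) and (a, b, c). *)
Lemma syzygy_square_row (A : idomainType) (x y a b c v0 v1 v2 : A) :
  x != 0 -> x * b - y * a != 0 ->
  regular_mod (dvdr x) y ->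
  regular_mod (dvdr (x * b - y * a)) (x * c - y * b) ->
  v0 * (x * y * c - y ^+ 2 * b) + v1 * (y ^+ 2 * a - x ^+ 2 * c)
    + v2 * (x ^+ 2 * b - x * y * a) = 0 ->
  exists w z, [/\ v0 = z * x ^+ 2 - w * a, v1 = z * (x * y) - w * b
                & v2 = z * y ^+ 2 - w * c].
Proof.
move=> x0 Q0 xy QP E.
have [|w Ew] := QP (v0 * y - v1 * x).
  by exists (v1 * y - v2 * x); apply: (eq_comb (k := 0) E E); ring.
have Ev1 : v1 * y = v2 * x + w * (x * c - y * b).
  apply: (mulIf Q0).
  by apply: (eq_comb (k := x * c - y * b) Ew (esym E)); ring.
have [|z' Ez'] := xy (v0 + w * a).
  by exists (v1 + w * b); apply: (eq_comb (k := 0) E Ew); ring.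
have Ev1' : v1 + w * b = z' * y.
  by apply: (mulIf x0); apply: (eq_comb (k := y) Ez' (esym Ew)); ring.
have [z Ez] : dvdr x z'.
  apply/xy/xy; exists (v2 + w * c).
  by apply: (eq_comb (k := - y) Ev1' Ev1); ring.
rewrite Ez in Ev1' Ez'; exists w, z; split.
- by apply: (eq_comb (k := 0) Ez' Ez'); ring.
- by apply: (eq_comb (k := 0) Ev1' Ev1'); ring.
- apply: (mulIf x0).
  by apply: (eq_comb (k := y) Ev1' (esym Ev1)); ring.
Qed.

Section MinorsElim.
Variables (K : numFieldType) (n : nat).
Local Notation S := {mpoly K[n]}.
Implicit Types (p q f g h v x y a b c : S) (i j : 'I_n).

(** A relation t f = v0 m0 + v1 m1 + v2 m2 reduces for t = 0 to a syzygy of the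
    minors with first row (x^2, xy, y^2). This syzygy is a combination of the
    rows, and the same combination of the original rows is a syzygy that can be
    subtracted from (v0, v1, v2) to make it divisible by t. *)
Lemma regular_square_row i x y a1 b1 c1 a b c :
  let t := 'X_i : S in
  kill i x = x -> kill i y = y -> kill i a = a -> kill i b = b ->
  kill i c = c -> x != 0 -> x * b - y * a != 0 ->
  regular_mod (dvdr x) y ->
  regular_mod (dvdr (x * b - y * a)) (x * c - y * b) ->
  regular_mod (in_minors (x ^+ 2 - t * a1) (x * y - t * b1) (y ^+ 2 - t * c1)
                 a b c) t.
Proof.
move=> t xi yi ai bi ci x0 Q0 xy QP f [[[v0 v1] v2] /= Ef].
have /esym := congr1 (kill i) Ef.
rewrite !(rmorphB, rmorphD, rmorphM, rmorphXn) /= killX eqxx xi yi ai bi ci.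
rewrite !mul0r !subr0.
move=> /(syzygy_square_row x0 Q0 xy QP) [w [z [e0 e1 e2]]].
have [q0 E0] := kill_mod i v0; have [q1 E1] := kill_mod i v1.
have [q2 E2] := kill_mod i v2.
rewrite e0 in E0; rewrite e1 in E1; rewrite e2 in E2.
exists (q0 + z * a1, q1 + z * b1, q2 + z * c1) => /=.
by apply: (mulfI (mpolyX_neq0 K i)); rewrite -/t Ef E0 E1 E2 -/t; ring.
Qed.

Lemma regular_nat (I : S -> Prop) (k : nat) :
  (forall r f, I f -> I (r * f)) -> (0 < k)%N -> regular_mod I k%:R.
Proof.
move=> IM k0; apply: (regular_inv (k := (k%:R^-1)%:MP)) => //.
by rewrite -(rmorph_nat (@mpolyC n K)) -mpolyCM mulVf ?pnatr_eq0 -?lt0n.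
Qed.

Lemma natr_neq0 (k : nat) : (0 < k)%N -> k%:R != 0 :> S.
Proof.
by move=> k0; rewrite -(rmorph_nat (@mpolyC n K)) mpolyC_eq0 pnatr_eq0 -lt0n.
Qed.

Lemma dvdrM q r f : dvdr q f -> dvdr q (r * f).
Proof. by move=> [s ->]; exists (r * s); rewrite mulrA. Qed.

(** The coprimality of the polynomials Q and P of the preceding syzygies. The
    variable of index i occurs in Q only, where it is linear with coefficient
    k 'X_j 'X_l, so P can be cancelled up to a power of this coefficient; and
    neither 'X_j nor 'X_l divides Q. *)
Lemma regular_binary_minor i j l (k : nat) x b s c :
  let Q := x * b - 'X_l * (s - k%:R * 'X_j * 'X_i) in
  (0 < k)%N -> i != j -> i != l ->
  kill i x = x -> kill i b = b -> kill i s = s -> kill i c = c ->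
  x * c - 'X_l * b != 0 -> kill j Q != 0 -> kill l Q != 0 ->
  regular_mod (dvdr Q) (x * c - 'X_l * b).
Proof.
move=> Q k0 ij il xi bi si ci P0 jQ lQ f.
pose h : S := k%:R * 'X_j * 'X_l; pose v : S := 'X_l * s - x * b.
have EQ : Q = h * 'X_i - v by rewrite /Q /h /v; ring.
have Xi m : i != m -> kill i 'X_m = 'X_m.
  by move=> im; rewrite killX eq_sym (negbTE im).
have h0 : h != 0 by rewrite !mulf_neq0 ?mpolyX_neq0 // natr_neq0.
have hi : kill i h = h by rewrite !rmorphM /= rmorph_nat !Xi.
have vi : kill i v = v by rewrite rmorphB !rmorphM /= xi bi si Xi.
rewrite EQ => /(gauss_linear hi vi h0); case=> // [|N].
  by rewrite rmorphB !rmorphM /= xi bi ci Xi.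
rewrite -EQ; apply: regularX => {}f.
apply: regularM; last by move=> ?; apply: dvdr_cancelX.
apply: regularM; last by move=> ?; apply: dvdr_cancelX.
by apply: regular_nat => //; exact: dvdrM.
Qed.

(** Given a f in the ideal, pseudo-division by a makes the coefficients of the
    minors free of 'X_i; since a is linear in this variable, the terms with and
    without a then vanish separately. What remains is a relation between b and
    c multiplied by a', and cancelling a' and then b against c, up to powers of
    h, h' and h2, exhibits f as a multiple of the minor b c' - c b' modulo the
    ideal. *)
Lemma regular_entry (i i' j : 'I_n) h v h' v' h2 v2 a b c a' b' c' :
  let I := in_minors a b c a' b' c' in
  a = v - h * 'X_i -> a' = v' - h' * 'X_i' -> b = v2 - h2 * 'X_j ->
  [/\ kill i h = h, kill i v = v & h != 0] ->
  [/\ kill i' h' = h', kill i' v' = v' & h' != 0] ->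
  [/\ kill j h2 = h2, kill j v2 = v2 & h2 != 0] ->
  [/\ kill i b = b, kill i c = c, kill i a' = a', kill i b' = b'
     & kill i c' = c'] ->
  [/\ kill i' b = b, kill i' c = c, kill i' b' = b' & kill i' c' = c'] ->
  kill j c = c ->
  [/\ a != 0, b != 0, c != 0, a' != 0 & b * c' - c * b' != 0] ->
  [/\ regular_mod I h, regular_mod I h' & regular_mod I h2] ->
  regular_mod I a.
Proof.
move=> I Ea Ea' Eb [hi vi h0] [h'i v'i h'0] [h2j v2j h20].
move=> [bi ci a'i b'i c'i] [bi' ci' b'i' c'i'] cj.
move=> [a0 b0 c0 a'0 m0] [Rh Rh' Rh2].
move=> f [[[u0 u1] u2] /= Ef].
have [N0 F0] := elim_var u0 hi vi; have [N1 F1] := elim_var u1 hi vi.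
have [N2 F2] := elim_var u2 hi vi.
pose N := (N0 + N1 + N2)%N.
have {F0}[|w0 w0i [s0 E0]] := F0 N; first by rewrite /N -addnA leq_addr.
have {F1}[|w1 w1i [s1 E1]] := F1 N; first by rewrite /N addnAC leq_addl.
have {F2}[|w2 w2i [s2 E2]] := F2 N; first by rewrite leq_addl.
have Eq : h * 'X_i - v = - a by rewrite Ea opprB.
rewrite Eq in E0 E1 E2.
set H := h ^+ N in E0 E1 E2.
pose f1 := H * f + s0 * (b * c' - c * b') + s1 * (c * a' - a * c')
           + s2 * (a * b' - b * a').
have Ef1 : a * (f1 + w1 * c' - w2 * b')
           = w0 * (b * c' - c * b') + a' * (w1 * c - w2 * b).
  have {}E0 : w0 = H * u0 + s0 * a.
    by apply: (eq_comb (k := -1) E0 (erefl 0)); ring.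
  have {}E1 : w1 = H * u1 + s1 * a.
    by apply: (eq_comb (k := -1) E1 (erefl 0)); ring.
  have {}E2 : w2 = H * u2 + s2 * a.
    by apply: (eq_comb (k := -1) E2 (erefl 0)); ring.
  by apply: (eq_comb (k := H) Ef (erefl 0)); rewrite /f1 E0 E1 E2; ring.
(* The left-hand side is free of 'X_i and, by Ef1, a multiple of a. *)
have R0 : w0 * (b * c' - c * b') + a' * (w1 * c - w2 * b) = 0.
  apply: (free_multiple_eq0 hi vi h0).
    rewrite !(rmorphB, rmorphD, rmorphM) /= w0i w1i w2i bi ci b'i c'i.
    by rewrite a'i.
  by exists (- (f1 + w1 * c' - w2 * b')); rewrite -Ef1 Eq; ring.
have {Ef1}Ef1 : f1 = w2 * b' - w1 * c'.
  apply: (mulfI a0); apply: (eq_comb (k := 1) Ef1 R0); ring.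
have Eq' : h' * 'X_i' - v' = - a' by rewrite Ea' opprB.
have Eq2 : h2 * 'X_j - v2 = - b by rewrite Eb opprB.
have [] := @gauss_linear K n i' h' v' (b * c' - c * b') w0 => //.
- by rewrite !(rmorphB, rmorphM) /= bi' ci' b'i' c'i'.
- exists (w1 * c - w2 * b); rewrite Eq'.
  by apply: (eq_comb (k := 1) R0 (erefl 0)); ring.
move=> N' [w]; set H' := h' ^+ N'; rewrite Eq' => Ew.
have Ecb : c * (H' * w1 + w * b') = b * (H' * w2 + w * c').
  apply: (mulfI a'0).
  have Em := congr1 ( *%R (b * c' - c * b')) (esym Ew).
  by apply: (eq_comb (k := H') R0 Em); ring.
(* As b is prime to c, this is a multiple of the Koszul relation. *)
have [|N2' [u]] :=
    @gauss_linear K n j h2 v2 c (H' * w1 + w * b') h2j v2j h20 cj c0.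
  by exists (- (H' * w2 + w * c')); rewrite Eq2 Ecb; ring.
set H2 := h2 ^+ N2'; rewrite Eq2 => Eu.
have Eu' : H2 * (H' * w2 + w * c') = - (u * c).
  apply: (mulfI b0); have Ec := congr1 ( *%R c) Eu.
  by apply: (eq_comb (k := - H2) Ecb Ec); ring.
apply: (regularX (N := N) Rh).
have Hf1 : H * f = f1 - s0 * (b * c' - c * b') - s1 * (c * a' - a * c')
           - s2 * (a * b' - b * a') by rewrite /f1; ring.
have If1 : I f1.
  apply: (regularX (N := N') Rh'); apply: (regularX (N := N2') Rh2).
  exists (u, 0, 0) => /=; rewrite -/H' -/H2 Ef1.
  by apply: (eq_comb (k := b') Eu' (esym (congr1 ( *%R c') Eu))); ring.
clearbody f1; rewrite -/H Hf1 -!addrA; apply: in_minorsD => //.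
by exists (- s0, - s1, - s2) => /=; ring.
Qed.

Lemma elim_two (i j : 'I_n) h v h' v' f : i != j ->
  [/\ kill i h = h, kill i v = v, kill i h' = h' & kill i v' = v'] ->
  [/\ kill j h = h, kill j v = v, kill j h' = h' & kill j v' = v'] ->
  exists N N' g r r', [/\ kill i g = g, kill j g = g
    & h ^+ N * h' ^+ N' * f = g + r * (h * 'X_i - v) + r' * (h' * 'X_j - v')].
Proof.
move=> ij [hi vi h'i v'i] [hj vj h'j v'j].
have [N /(_ N (leqnn _)) [g gi [r Er]]] := elim_var f hi vi.
have [N' /(_ N' (leqnn _)) [g' g'j [r' Er']]] := elim_var g h'j v'j.
exists N, N', (kill i g'), (h' ^+ N' * r), (kill i r'); split.
- exact: kill_idem.
- by rewrite kill_comm g'j.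
have := congr1 (kill i) Er'.
rewrite !(rmorphB, rmorphM, rmorphXn) /= h'i gi v'i killX.
rewrite eq_sym (negbTE ij) => E.
by apply: (eq_comb (k := h' ^+ N') Er E); ring.
Qed.
End MinorsElim.

(** * The ideal of the tangency minors *)

Lemma meval_neq0 (K : numFieldType) n (p : {mpoly K[n]}) w :
  p.@[w] != 0 -> p != 0.
Proof. by apply: contra_neq => ->; rewrite meval0. Qed.

Lemma kill_neq0 (K : numFieldType) n i (p : {mpoly K[n]}) w :
  w i = 0 -> p.@[w] != 0 -> kill i p != 0.
Proof.
move=> wi pw; apply: (@meval_neq0 _ _ _ w); rewrite meval_kill.
by rewrite (@meval_eq _ _ _ w) // => j; case: eqP => [->|].
Qed.

Section DiscriminantEntries.
Variable K : numFieldType.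
Local Notation S := {mpoly K[6 + 6]}.
Local Notation g i := ('X_(lshift 6 i) : S).
Local Notation d i := ('X_(rshift 6 i) : S).

(** The discriminant of gamma with respect to x2 is
    qgamma00 x0^2 + 2 qgamma01 x0 x1 + qgamma11 x1^2, and that of delta with
    respect to its first variable is the form with coefficients qdelta00,
    2 qdelta01 and qdelta11 in its other two variables. *)
Definition qgamma11 : S := g 4 ^+ 2 - 4 * g 3 * g 5.
Definition qgamma01 : S := g 2 * g 4 - 2 * g 1 * g 5.
Definition qgamma00 : S := g 2 ^+ 2 - 4 * g 0 * g 5.
Definition qdelta11 : S := d 2 ^+ 2 - 4 * d 0 * d 5.
Definition qdelta01 : S := d 1 * d 2 - 2 * d 0 * d 4.
Definition qdelta00 : S := d 1 ^+ 2 - 4 * d 0 * d 3.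

(** Index k < 6 refers to the coordinate gamma_k and 6 + k to delta_k. At a
    suitable point of this kind the polynomials that have to be nonzero take the
    value 1. *)
Definition indicator_point (s : seq nat) (i : 'I_(6 + 6)) : K :=
  ((i : nat) \in s)%:R.

End DiscriminantEntries.

Ltac simpl_kill :=
  rewrite /qgamma11 /qgamma01 /qgamma00 /qdelta11 /qdelta01 /qdelta00
    ?(rmorphB, rmorphD, rmorphM, rmorphXn) /= ?rmorphB ?rmorph1 ?killX
    ?eq_lshift ?eq_rshift ?eq_lrshift ?eq_rlshift /=; ring.

Ltac eval_to_one :=
  rewrite /qgamma11 /qgamma01 /qgamma00 /qdelta11 /qdelta01 /qdelta00
    ?(mevalB, mevalD, mevalM, rmorphXn, mevalXU) /= ?meval1
    /indicator_point /= ?(mulr0, mul0r, mulr1, subr0, mul1r, expr2)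
    oner_neq0; done.

Section Regularity.
Variable K : numFieldType.
Local Notation S := {mpoly K[6 + 6]}.
Local Notation g i := ('X_(lshift 6 i) : S).
Local Notation d i := ('X_(rshift 6 i) : S).
Local Notation G11 := (qgamma11 K).
Local Notation G01 := (qgamma01 K).
Local Notation G00 := (qgamma00 K).
Local Notation D11 := (qdelta11 K).
Local Notation D01 := (qdelta01 K).
Local Notation D00 := (qdelta00 K).
Local Notation I := (in_minors G11 G01 G00 D11 D01 D00).
Local Notation pt := (@indicator_point K).

Lemma qgamma11_neq0 : G11 != 0.
Proof. by apply: (@meval_neq0 _ _ _ (pt [:: 4])); eval_to_one. Qed.

Lemma qdelta11_neq0 : D11 != 0.
Proof. by apply: (@meval_neq0 _ _ _ (pt [:: 8])); eval_to_one. Qed.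

Lemma regular_gamma5 : regular_mod I (g 5).
Proof.
have -> : G11 = g 4 ^+ 2 - g 5 * (4 * g 3) by rewrite /qgamma11; ring.
have -> : G01 = g 4 * g 2 - g 5 * (2 * g 1) by rewrite /qgamma01; ring.
have -> : G00 = g 2 ^+ 2 - g 5 * (4 * g 0) by rewrite /qgamma00; ring.
apply: (@regular_square_row _ _ (lshift 6 5)
  (g 4) (g 2) (4 * g 3) (2 * g 1) (4 * g 0) D11 D01 D00).
1-5: by simpl_kill.
- exact: mpolyX_neq0.
- by apply: (@meval_neq0 _ _ _ (pt [:: 4; 7; 8])); eval_to_one.
- by move=> f; apply: gaussX; rewrite killX eq_lshift mpolyX_neq0.
apply: (@regular_binary_minor _ _ (rshift 6 5) (rshift 6 0) (lshift 6 2) 4)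
  => //.
1-4: by simpl_kill.
- by apply: (@meval_neq0 _ _ _ (pt [:: 4; 7; 8])); eval_to_one.
- by apply: (@kill_neq0 _ _ _ _ (pt [:: 4; 7; 8])); [|eval_to_one].
- by apply: (@kill_neq0 _ _ _ _ (pt [:: 4; 7; 8])); [|eval_to_one].
Qed.

Lemma regular_delta0 : regular_mod I (d 0).
Proof.
move=> f /in_minors_swap E; apply/in_minors_swap; move: f E.
have -> : D11 = d 2 ^+ 2 - d 0 * (4 * d 5) by rewrite /qdelta11; ring.
have -> : D01 = d 2 * d 1 - d 0 * (2 * d 4) by rewrite /qdelta01; ring.
have -> : D00 = d 1 ^+ 2 - d 0 * (4 * d 3) by rewrite /qdelta00; ring.
apply: (@regular_square_row _ _ (rshift 6 0)
  (d 2) (d 1) (4 * d 5) (2 * d 4) (4 * d 3) G11 G01 G00).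
1-5: by simpl_kill.
- exact: mpolyX_neq0.
- by apply: (@meval_neq0 _ _ _ (pt [:: 8; 2; 4])); eval_to_one.
- by move=> f; apply: gaussX; rewrite killX eq_rshift mpolyX_neq0.
(* The form in which gamma3 is the distinguished linear variable. *)
have -> : G11 = g 4 ^+ 2 - 4 * g 5 * g 3 by rewrite /qgamma11; ring.
apply: (@regular_binary_minor _ _ (lshift 6 3) (lshift 6 5) (rshift 6 1) 4)
  => //.
1-4: by simpl_kill.
- by apply: (@meval_neq0 _ _ _ (pt [:: 8; 2; 4])); eval_to_one.
- by apply: (@kill_neq0 _ _ _ _ (pt [:: 8; 2; 4])); [|eval_to_one].
- by apply: (@kill_neq0 _ _ _ _ (pt [:: 8; 2; 4])); [|eval_to_one].
Qed.

Lemma regular_qgamma11 : regular_mod I G11.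
Proof.
apply: (@regular_entry _ _ (lshift 6 3) (rshift 6 5) (lshift 6 1)
  (4 * g 5) (g 4 ^+ 2) (4 * d 0) (d 2 ^+ 2) (2 * g 5) (g 2 * g 4)).
1-3: rewrite /qgamma11 /qdelta11 /qgamma01; ring.
1-3: split; [simpl_kill|simpl_kill|].
1-3: by rewrite mulf_neq0 ?natr_neq0 ?mpolyX_neq0.
1-2: by split; simpl_kill.
- by simpl_kill.
- split; last by apply: (@meval_neq0 _ _ _ (pt [:: 2; 4; 7])); eval_to_one.
  1-4: by apply: (@meval_neq0 _ _ _ (pt [:: 2; 4; 8])); eval_to_one.
- have R4 k : (0 < k)%N -> regular_mod I k%:R.
    by apply: regular_nat => r f; apply: in_minorsM.
  split; apply: regularM; do ?exact: R4.
  + exact: regular_gamma5.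
  + exact: regular_delta0.
  + exact: regular_gamma5.
Qed.
End Regularity.

Section Vanishing.
Variable K : numClosedFieldType.
Local Notation S := {mpoly K[6 + 6]}.
Local Notation g i := ('X_(lshift 6 i) : S).
Local Notation d i := ('X_(rshift 6 i) : S).
Local Notation G11 := (qgamma11 K).
Local Notation G01 := (qgamma01 K).
Local Notation G00 := (qgamma00 K).
Local Notation D11 := (qdelta11 K).
Local Notation D01 := (qdelta01 K).
Local Notation D00 := (qdelta00 K).
Local Notation I := (in_minors G11 G01 G00 D11 D01 D00).

Lemma meval_nat n (w : 'I_n -> K) k : (k%:R : {mpoly K[n]}).@[w] = k%:R.
Proof. exact: rmorph_nat. Qed.

Local Notation rw w i := (w (rshift 6 i)).

Lemma meval_qdelta01 w : D01.@[w] = rw w 1 * rw w 2 - 2 * rw w 0 * rw w 4.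
Proof. by rewrite /qdelta01 !(mevalB, mevalM, mevalXU, meval_nat). Qed.

Lemma meval_qdelta00 w : D00.@[w] = rw w 1 ^+ 2 - 4 * rw w 0 * rw w 3.
Proof.
by rewrite /qdelta00 !(mevalB, mevalM, mevalXU, meval_nat, rmorphXn).
Qed.

Lemma meval_comb w (p r r' a b c a' b' c' : S) :
  (p + r * (b * a' - a * b') + r' * (c * a' - a * c')).@[w] =
  p.@[w] + r.@[w] * (b.@[w] * a'.@[w] - a.@[w] * b'.@[w])
  + r'.@[w] * (c.@[w] * a'.@[w] - a.@[w] * c'.@[w]).
Proof. by rewrite !(mevalB, mevalD, mevalM). Qed.

(** The points w in the hypothesis are general points of the joint image. The
    minors with G11 are linear in delta4 and delta3, with coefficients
    2 G11 delta0 and 4 G11 delta0 up to sign, so these variables can be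
    eliminated from f. The result is 0, because for general values of the other
    coordinates there are values of delta4 and delta3 for which the hypothesis
    applies; the scale of the rows is a square, as K is algebraically closed. *)
Lemma vanishing_in_minors f :
  (forall w r, w (lshift 6 5) != 0 -> w (rshift 6 0) != 0 -> r != 0 ->
     G11.@[w] = r ^+ 2 * D11.@[w] -> G01.@[w] = r ^+ 2 * D01.@[w] ->
     G00.@[w] = r ^+ 2 * D00.@[w] -> f.@[w] = 0) ->
  I f.
Proof.
move=> f0.
case: (@elim_two K _ (rshift 6 4) (rshift 6 3)
  (2 * G11 * d 0) (G11 * (d 1 * d 2) - G01 * D11)
  (4 * G11 * d 0) (G11 * d 1 ^+ 2 - G00 * D11) f isT).
1-2: by split; simpl_kill.
move=> N [N' [p [r [r' [pi pj E]]]]].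
have q1E : 2 * G11 * d 0 * d 4 - (G11 * (d 1 * d 2) - G01 * D11)
           = G01 * D11 - G11 * D01.
  by rewrite /qdelta01; ring.
have q2E : 4 * G11 * d 0 * d 3 - (G11 * d 1 ^+ 2 - G00 * D11)
           = G00 * D11 - G11 * D00.
  by rewrite /qdelta00; ring.
rewrite q1E q2E in E.
have p0 : p = 0.
  have /eqP : G11 * D11 * g 5 * d 0 * p = 0.
    apply: mpoly_fun_eq0 => w; rewrite mevalM.
    have [->|] := eqVneq (G11 * D11 * g 5 * d 0).@[w] 0; first by rewrite mul0r.
    rewrite !mevalM !mevalXU !mulf_eq0 !negb_or -!andbA => /and4P [A1 A2 G5 D0].
    (* The scale from the first row of the matrix to the second one; x and y
       are the values of delta4 and delta3 that it forces. *)
    pose rho := D11.@[w] / G11.@[w].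
    pose x := (w (rshift 6 1) * w (rshift 6 2) - G01.@[w] * rho)
              / (2 * w (rshift 6 0)).
    pose y := (w (rshift 6 1) ^+ 2 - G00.@[w] * rho) / (4 * w (rshift 6 0)).
    pose w' := upd (rshift 6 3) y (upd (rshift 6 4) x w).
    have free (q : S) : kill (rshift 6 4) q = q -> kill (rshift 6 3) q = q ->
        q.@[w'] = q.@[w].
      by move=> q4 q3; rewrite /w' !meval_free.
    have a1w : G11.@[w'] = G11.@[w] by apply: free; simpl_kill.
    have b1w : G01.@[w'] = G01.@[w] by apply: free; simpl_kill.
    have c1w : G00.@[w'] = G00.@[w] by apply: free; simpl_kill.
    have a2w : D11.@[w'] = D11.@[w] by apply: free; simpl_kill.
    have b2w : D01.@[w'] = G01.@[w] * rho.
      rewrite meval_qdelta01 /w' /upd !eq_rshift /= -/x.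
      have -> : rw w 1 * rw w 2 = 2 * rw w 0 * x + G01.@[w] * rho; last by ring.
      by rewrite /x; field; exact: D0.
    have c2w : D00.@[w'] = G00.@[w] * rho.
      rewrite meval_qdelta00 /w' /upd !eq_rshift /= -/y.
      have -> : rw w 1 ^+ 2 = 4 * rw w 0 * y + G00.@[w] * rho; last by ring.
      by rewrite /y; field; exact: D0.
    have rho0 : rho != 0 by rewrite mulf_neq0 ?invr_neq0.
    have fw' : f.@[w'] = 0.
      apply: (f0 _ (sqrtC rho)^-1).
      - by rewrite /w' /upd !eq_lrshift.
      - by rewrite /w' /upd !eq_rshift.
      - by rewrite invr_neq0 ?sqrtC_eq0.
      - by rewrite exprVn sqrtCK a1w a2w /rho invf_div divfK.
      - by rewrite exprVn sqrtCK b1w b2w mulrC mulfK.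
      - by rewrite exprVn sqrtCK c1w c2w mulrC mulfK.
    have := congr1 (meval w') E.
    rewrite mevalM fw' mulr0 meval_comb a1w b1w c1w a2w b2w c2w.
    rewrite (free p pi pj) => E'; rewrite -[RHS](mulr0 0).
    suff -> : p.@[w] = 0 by rewrite !mulr0.
    rewrite [RHS]E' /rho; field; exact: A1.
  have h0 : G11 * D11 * g 5 * d 0 != 0.
    rewrite mulf_neq0 ?mpolyX_neq0 // mulf_neq0 ?mpolyX_neq0 // mulf_neq0 //.
      exact: qgamma11_neq0.
    exact: qdelta11_neq0.
  by rewrite mulf_eq0 (negbTE h0) => /eqP.
rewrite p0 add0r in E.
have R4 k : (0 < k)%N -> regular_mod I k%:R.
  by apply: regular_nat => q h; apply: in_minorsM.
have Rh k : (0 < k)%N -> regular_mod I (k%:R * G11 * d 0).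
  move=> k0; apply: regularM; last exact: regular_delta0.
  by apply: regularM; [exact: R4|exact: regular_qgamma11].
apply: (regularX (N := N') (Rh 4 isT)); apply: (regularX (N := N) (Rh 2 isT)).
by rewrite mulrA E; exists (0, r', - r) => /=; ring.
Qed.
End Vanishing.

(** * The joint image *)

Lemma nu22M (K : comNzRingType) (A B : 'M[K]_3) :
  nu22 (A *m B) = nu22 A *m nu22 B.
Proof.
by apply/esym/nu22P => x; rewrite -mulmxA !nu22_mul mulmxA.
Qed.

Lemma nu22_scalar (K : comNzRingType) (s : K) : nu22 s%:M = (s ^+ 2)%:M.
Proof.
apply/esym/nu22P => x; rewrite !mul_scalar_mx.
by apply/colP => k; rewrite !mxE; ring.
Qed.

Lemma nu22_unit (K : fieldType) (A : 'M[K]_3) :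
  A \in unitmx -> nu22 A \in unitmx.
Proof.
move=> Au; have /mulmx1_unit [] // : nu22 A *m nu22 (invmx A) = 1%:M.
by rewrite -nu22M mulmxV // nu22_scalar expr1n.
Qed.

Section Cameras.
Variable K : fieldType.
Implicit Types (h : 'cV[K]_4) (gamma delta alpha : 'cV[K]_6) (s : K).

Lemma camera1_plane h : camera1 K *m plane_mx h = (h 0 0)%:M.
Proof. by rewrite [LHS](@mul_row_col K 3 1 3) mul0mx add0r mul1mx. Qed.

(** The second camera on the chart of a plane, with (s, - u) the plane. *)
Definition second_chart (s u0 u1 u2 : K) : 'M[K]_3 :=
  \matrix_(i, j) nth 0 (nth [::]
    [:: [:: u0; u1; u2]; [:: s; 0; 0]; [:: 0; s; 0]] i) j.

Lemma camera2_plane h :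
  camera2 K *m plane_mx h
  = second_chart (h 0 0) (- h 1 0) (- h 2 0) (- h 3 0).
Proof.
rewrite -[plane_mx h](@vsubmxK K 3 1 3) [LHS](@mul_row_col K 3 3 1).
rewrite mul1mx mul0mx addr0; apply/matrixP => i j; rewrite [LHS]mxE [RHS]mxE.
case: i => [[|[|[|//]]] hi].
- have -> : lshift 1 (Ordinal hi) = lshift 3 0 :> 'I_(1 + 3) by apply: val_inj.
  rewrite [LHS](@col_mxEu K 1 3 3) mxE.
  by case: j => [[|[|[|//]]] hj] /=; congr (- h _ _); apply: val_inj.
- have -> : lshift 1 (Ordinal hi) = rshift 1 0 :> 'I_(1 + 3) by apply: val_inj.
  rewrite [LHS](@col_mxEd K 1 3 3) mxE.
  by case: j => [[|[|[|//]]] hj] /=.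
- have -> : lshift 1 (Ordinal hi) = rshift 1 1 :> 'I_(1 + 3) by apply: val_inj.
  rewrite [LHS](@col_mxEd K 1 3 3) mxE.
  by case: j => [[|[|[|//]]] hj] /=.
Qed.

(** Coefficients of the quadratic form delta(u . x, s x0, s x1). *)
Definition pullback (s u0 u1 u2 : K) (x : 'cV[K]_6) : 'cV[K]_6 :=
  \col_i nth 0
    [:: x 0 0 * u0 ^+ 2 + x 1 0 * s * u0 + x 3 0 * s ^+ 2;
        2 * x 0 0 * u0 * u1 + x 1 0 * s * u1 + x 2 0 * s * u0 + x 4 0 * s ^+ 2;
        2 * x 0 0 * u0 * u2 + x 1 0 * s * u2;
        x 0 0 * u1 ^+ 2 + x 2 0 * s * u1 + x 5 0 * s ^+ 2;
        2 * x 0 0 * u1 * u2 + x 2 0 * s * u2;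
        x 0 0 * u2 ^+ 2] i.

Lemma pullbackE s u0 u1 u2 x :
  (nu22 (second_chart s u0 u1 u2))^T *m x = pullback s u0 u1 u2 x.
Proof.
apply/colP => i; rewrite mxE.
have o1 : lift ord0 ord0 = 1 :> 'I_6 by apply: val_inj.
have o2 : lift ord0 (lift ord0 ord0) = 2 :> 'I_6 by apply: val_inj.
have o3 : lift ord0 (lift ord0 (lift ord0 ord0)) = 3 :> 'I_6 by apply: val_inj.
have o4 : lift ord0 (lift ord0 (lift ord0 (lift ord0 ord0))) = 4 :> 'I_6
  by apply: val_inj.
have o5 :
    lift ord0 (lift ord0 (lift ord0 (lift ord0 (lift ord0 ord0)))) = 5 :> 'I_6
  by apply: val_inj.
have o0 : ord0 = 0 :> 'I_6 by apply: val_inj.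
rewrite !big_ord_recl big_ord0 o5 o4 o3 o2 o1 o0.
rewrite /pullback /second_chart.
by case: i => [[|[|[|[|[|[|//]]]]]] hi]; rewrite !mxE /= !mxE /=; ring.
Qed.

Lemma second_chart_unit s u0 u1 u2 :
  s != 0 -> u2 != 0 -> second_chart s u0 u1 u2 \in unitmx.
Proof.
move=> s0 u20.
pose B : 'M[K]_3 := \matrix_(i, j) nth 0 (nth [::]
  [:: [:: 0; s^-1; 0]; [:: 0; 0; s^-1];
      [:: u2^-1; - (u0 / (s * u2)); - (u1 / (s * u2))]] i) j.
have /mulmx1_unit[] // : second_chart s u0 u1 u2 *m B = 1%:M.
apply/matrixP => i j; rewrite !mxE !big_ord_recl big_ord0 !mxE.
by case: i => [[|[|[|//]]] hi]; case: j => [[|[|[|//]]] hj] /=; field;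
  rewrite ?s0 ?u20.
Qed.

Lemma joint_image_pullback p :
  joint_image (camera1 K) (camera2 K) p ->
  [/\ p.1 != 0, p.2 != 0
    & exists k s u0 u1 u2, p.1 = k *: pullback s u0 u1 u2 p.2].
Proof.
move=> [h [alpha [[h0 a0 C1u C2u] [[k1 k10 E1] [k2 k20 E2]]]]].
have s0 : h 0 0 != 0.
  apply: contraTneq C1u => s0.
  by rewrite camera1_plane s0 unitmxE det_scalar expr0n unitr0.
have {}E1 : p.1 = (k1 * (h 0 0) ^- 2) *: alpha.
  rewrite E1 /camera_conic camera1_plane nu22_scalar invmx_scalar.
  by rewrite tr_scalar_mx mul_scalar_mx scalerA.
have {}E2 : alpha = k2^-1 *: pullback (h 0 0) (- h 1 0) (- h 2 0) (- h 3 0) p.2.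
  rewrite -pullbackE -camera2_plane E2 /camera_conic -scalemxAr scalerA.
  rewrite mulVf // scale1r mulmxA -trmx_mul.
  by rewrite mulVmx ?nu22_unit // trmx1 mul1mx.
split.
- by rewrite E1 scaler_eq0 negb_or a0 mulf_neq0 // invr_neq0 // expf_neq0.
- by apply: contraNneq a0 => p20; rewrite E2 p20 -pullbackE mulmx0 scaler0 eqxx.
- exists (k1 * h 0 0 ^- 2 * k2^-1), (h 0 0), (- h 1 0), (- h 2 0), (- h 3 0).
  by rewrite E1 {1}E2 scalerA.
Qed.

Lemma pullback_joint_image k u0 u1 u2 gamma delta :
  gamma != 0 -> k != 0 -> u2 != 0 ->
  gamma = k *: pullback 1 u0 u1 u2 delta ->
  joint_image (camera1 K) (camera2 K) (gamma, delta).
Proof.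
move=> g0 k0 u20 E.
pose h : 'cV[K]_4 := \col_i nth 0 [:: 1; - u0; - u1; - u2] i.
have h00 : h 0 0 = 1 by rewrite mxE.
have E2 : camera2 K *m plane_mx h = second_chart 1 u0 u1 u2.
  by rewrite camera2_plane !mxE /= !opprK.
have U2 : camera2 K *m plane_mx h \in unitmx.
  by rewrite E2 second_chart_unit ?oner_neq0.
exists h, gamma; split; split.
- by apply: contraTneq (oner_neq0 K) => h0; rewrite -h00 h0 mxE eqxx.
- by [].
- by rewrite camera1_plane h00 unitmx1.
- by [].
- exists 1; first exact: oner_neq0.
  rewrite /camera_conic camera1_plane h00 nu22_scalar expr1n invmx1.
  by rewrite trmx1 mul1mx scale1r.
- exists k^-1; first by rewrite invr_neq0.
  rewrite /camera_conic -[in RHS]/gamma [in RHS]E -pullbackE -E2.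
  rewrite -scalemxAr scalerA mulVf // scale1r mulmxA -trmx_mul.
  by rewrite mulmxV ?nu22_unit // trmx1 mul1mx.
Qed.
End Cameras.

(** Completing squares, 4 gamma5 gamma and 4 delta0 delta are the differences of
    the square of a linear form and the discriminant. The plane is chosen so
    that the substitution maps the linear form of delta, times r, to that of
    gamma; the proportional discriminants then make gamma a multiple of the
    pullback of delta. *)
Lemma discriminant_joint_image (K : numFieldType) (r : K)
    (gamma delta : 'cV[K]_6) :
  gamma 5 0 != 0 -> delta 0 0 != 0 -> r != 0 ->
  gamma 4 0 ^+ 2 - 4 * gamma 3 0 * gamma 5 0
    = r ^+ 2 * (delta 2 0 ^+ 2 - 4 * delta 0 0 * delta 5 0) ->
  gamma 2 0 * gamma 4 0 - 2 * gamma 1 0 * gamma 5 0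
    = r ^+ 2 * (delta 1 0 * delta 2 0 - 2 * delta 0 0 * delta 4 0) ->
  gamma 2 0 ^+ 2 - 4 * gamma 0 0 * gamma 5 0
    = r ^+ 2 * (delta 1 0 ^+ 2 - 4 * delta 0 0 * delta 3 0) ->
  joint_image (camera1 K) (camera2 K) (gamma, delta).
Proof.
set g0 := gamma 0 0; set g1 := gamma 1 0; set g2 := gamma 2 0.
set g3 := gamma 3 0; set g4 := gamma 4 0; set g5 := gamma 5 0.
move=> g50 d00 r0 Ea Eb Ec.
have g3E : g3
    = (g4 ^+ 2 - r ^+ 2 * (delta 2 0 ^+ 2 - 4 * delta 0 0 * delta 5 0))
      / (4 * g5).
  by rewrite -Ea; field; exact: g50.
have g1E : g1
    = (g2 * g4
       - r ^+ 2 * (delta 1 0 * delta 2 0 - 2 * delta 0 0 * delta 4 0))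
      / (2 * g5).
  by rewrite -Eb; field; exact: g50.
have g0E : g0
    = (g2 ^+ 2 - r ^+ 2 * (delta 1 0 ^+ 2 - 4 * delta 0 0 * delta 3 0))
      / (4 * g5).
  by rewrite -Ec; field; exact: g50.
apply: (@pullback_joint_image _ (r ^+ 2 * delta 0 0 / g5)
  ((g2 / r - delta 1 0) / (2 * delta 0 0))
  ((g4 / r - delta 2 0) / (2 * delta 0 0))
  (g5 / (r * delta 0 0))).
- by apply: contraNneq g50 => g0'; rewrite /g5 g0' mxE.
- by rewrite !mulf_neq0 ?invr_neq0 ?expf_neq0.
- by rewrite !mulf_neq0 ?invr_neq0 ?mulf_neq0.
have gE m (hm : (m < 6)%N) (j : 'I_6) :
    (j : nat) = m -> gamma (Ordinal hm) 0 = gamma j 0.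
  by move=> jm; congr (gamma _ 0); apply: val_inj.
apply/colP; case=> [[|[|[|[|[|[|//]]]]]] hi]; rewrite !mxE /=.
- by rewrite (gE _ _ 0 erefl) -/g0 g0E; field; rewrite g50 d00 r0.
- by rewrite (gE _ _ 1 erefl) -/g1 g1E; field; rewrite g50 d00 r0.
- by rewrite (gE _ _ 2 erefl) -/g2; field; rewrite g50 d00 r0.
- by rewrite (gE _ _ 3 erefl) -/g3 g3E; field; rewrite g50 d00 r0.
- by rewrite (gE _ _ 4 erefl) -/g4; field; rewrite g50 d00 r0.
- by rewrite (gE _ _ 5 erefl) -/g5; field; rewrite g50 d00 r0.
Qed.

(** * The rank condition *)

Lemma minor2E (A : comNzRingType) n (M : 'M[A]_(2, n)) s :
  minor2 M s = M 0 (s 0) * M 1 (s 1) - M 0 (s 1) * M 1 (s 0).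
Proof.
rewrite /minor2 (expand_det_row _ 0) !big_ord_recl big_ord0 /cofactor !det_mx11.
rewrite !mxE /=.
have -> : ord0 = 0 :> 'I_2 by apply: val_inj.
have -> : lift 0 0 = 1 :> 'I_2 by apply: val_inj.
have -> : lift 1 0 = 0 :> 'I_2 by apply: val_inj.
rewrite /= !expr0 expr1; ring.
Qed.

Lemma rank_le1P (K : fieldType) n (M : 'M[K]_(2, n)) :
  reflect (forall s, minor2 M s = 0) (\rank M <= 1)%N.
Proof.
apply: (iffP idP) => [rk s | M0].
  apply/eqP; apply: contraLR rk; rewrite -ltnNge => dM.
  have U : colsub s M \in unitmx by rewrite unitmxE unitfE.
  rewrite -[X in (X <= _)%N](mxrank_unit U) -mxrank_tr -[\rank M]mxrank_tr.
  have -> : (colsub s M)^T = rowsub s M^T by apply/matrixP => i j; rewrite !mxE.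
  by apply: mxrankS; apply: rowsub_sub.
rewrite leqNgt; apply/negP => rk.
have fM : row_full M^T by rewrite /row_full mxrank_tr eqn_leq rank_leq_row.
have := fullrowsub_unit fM; rewrite -unitmx_tr unitmxE unitfE.
have -> : (rowsub (fullrankfun fM) M^T)^T = colsub (fullrankfun fM) M.
  by apply/matrixP => i j; rewrite !mxE.
by move: (M0 (fullrankfun fM)); rewrite /minor2 => ->; rewrite eqxx.
Qed.

(** * Bihomogeneity of the minors *)

Section Bihomogeneous.
Variable K : fieldType.
Implicit Types f g : {mpoly K[6 + 6]}.

Definition bidegree d e f := forall m, m \in msupp f ->
  (\sum_(i < 6) m (lshift 6 i) = d)%N /\ (\sum_(i < 6) m (rshift 6 i) = e)%N.

Lemma bidegreeB d e f g :
  bidegree d e f -> bidegree d e g -> bidegree d e (f - g).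
Proof.
move=> hf hg m /msuppB_le; rewrite mem_cat => /orP[]; [exact: hf|exact: hg].
Qed.

Lemma bidegreeM d e d' e' f g :
  bidegree d e f -> bidegree d' e' g -> bidegree (d + d') (e + e') (f * g).
Proof.
move=> hf hg m /msuppM_le /allpairsP [[u v] /= [/hf [ul ur] /hg [vl vr] ->]].
split.
  by rewrite -ul -vl -big_split; apply: eq_bigr => i _; rewrite mnmDE.
by rewrite -ur -vr -big_split; apply: eq_bigr => i _; rewrite mnmDE.
Qed.

Lemma bidegree_nat k : bidegree 0 0 (k%:R : {mpoly K[6 + 6]}).
Proof.
move=> m; rewrite -(rmorph_nat (@mpolyC (6 + 6) K)) msuppC.
case: ifP => // _; rewrite inE => /eqP ->.
by split; apply: big1 => i _; rewrite mnmE.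
Qed.

Lemma bidegree_gamma i : bidegree 1 0 (gamma_vars K i 0).
Proof.
move=> m; rewrite mxE msuppX inE => /eqP ->.
split.
  rewrite (bigD1 i) //= mnm1E eqxx big1 // => j ji.
  by rewrite mnm1E eq_lshift eq_sym (negbTE ji).
by apply: big1 => j _; rewrite mnm1E eq_lrshift.
Qed.

Lemma bidegree_delta i : bidegree 0 1 (delta_vars K i 0).
Proof.
move=> m; rewrite mxE msuppX inE => /eqP ->.
split; first by apply: big1 => j _; rewrite mnm1E eq_rlshift.
rewrite (bigD1 i) //= mnm1E eqxx big1 // => j ji.
by rewrite mnm1E eq_rshift eq_sym (negbTE ji).
Qed.

Lemma bidegree_row0 j :
  bidegree 2 0 (tangency_mx (gamma_vars K) (delta_vars K) 0 j).
Proof.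
have G := bidegree_gamma; have N := bidegree_nat.
rewrite mxE /=; case: j => [[|[|[|//]]] hj] /=.
all: apply: bidegreeB; do ?[exact: G|exact: (N 2)|exact: (N 4)
  |apply: (bidegreeM (d := 1) (d' := 1) (e := 0) (e' := 0))
  |apply: (bidegreeM (d := 0) (d' := 1) (e := 0) (e' := 0))].
Qed.

Lemma bidegree_row1 j :
  bidegree 0 2 (tangency_mx (gamma_vars K) (delta_vars K) 1 j).
Proof.
have G := bidegree_delta; have N := bidegree_nat.
rewrite mxE /=; case: j => [[|[|[|//]]] hj] /=.
all: apply: bidegreeB; do ?[exact: G|exact: (N 2)|exact: (N 4)
  |apply: (bidegreeM (d := 0) (d' := 0) (e := 1) (e' := 1))
  |apply: (bidegreeM (d := 0) (d' := 0) (e := 0) (e' := 1))].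
Qed.

Lemma bihomogeneous_minor2 s :
  bihomogeneous (minor2 (tangency_mx (gamma_vars K) (delta_vars K)) s).
Proof.
exists 2%N, 2%N; rewrite minor2E -/(bidegree _ _ _).
apply: bidegreeB; apply: (bidegreeM (d := 2) (d' := 0) (e := 0) (e' := 2));
  by [exact: bidegree_row0|exact: bidegree_row1].
Qed.
End Bihomogeneous.

(** * The conic multiview variety and its ideal *)

Section IdealGenerated.
Variables (A : comNzRingType) (J : finType) (g : J -> A).

Lemma ideal_generated_gen j : ideal_generated g (g j).
Proof.
exists (fun k => (k == j)%:R); rewrite (bigD1 j) //= eqxx mul1r big1 ?addr0 //.
by move=> k /negbTE ->; rewrite mul0r.
Qed.

Lemma ideal_generatedD x y :
  ideal_generated g x -> ideal_generated g y -> ideal_generated g (x + y).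
Proof.
move=> [u ->] [v ->]; exists (fun j => u j + v j).
by rewrite -big_split; apply: eq_bigr => j _; rewrite mulrDl.
Qed.

Lemma ideal_generatedM r x : ideal_generated g x -> ideal_generated g (r * x).
Proof.
move=> [u ->]; exists (fun j => r * u j).
by rewrite mulr_sumr; apply: eq_bigr => j _; rewrite mulrA.
Qed.

End IdealGenerated.

Lemma in_minors_ideal_generated (A : comNzRingType) (M : 'M[A]_(2, 3)) f :
  in_minors (M 0 0) (M 0 1) (M 0 2) (M 1 0) (M 1 1) (M 1 2) f ->
  ideal_generated (minor2 M) f.
Proof.
move=> [v ->].
pose s (j k : 'I_3) : {ffun 'I_2 -> 'I_3} :=
  [ffun i => if i == 0 then j else k].
have mE j k : M 0 j * M 1 k - M 0 k * M 1 j = minor2 M (s j k).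
  by rewrite minor2E !ffunE.
rewrite !mE; do 2?apply: ideal_generatedD; apply: ideal_generatedM;
  exact: ideal_generated_gen.
Qed.

Lemma map_tangency_mx (A B : comNzRingType) (f : {rmorphism A -> B})
    (x y : 'cV[A]_6) :
  map_mx f (tangency_mx x y) = tangency_mx (map_mx f x) (map_mx f y).
Proof.
apply/matrixP => i j; rewrite !mxE.
by case: i => [[|[|//]] hi]; case: j => [[|[|[|//]]] hj];
  rewrite /= rmorphB !rmorphM /= rmorph_nat.
Qed.

Section Evaluation.
Variable K : fieldType.
Implicit Types (p : 'cV[K]_6 * 'cV[K]_6) (f : {mpoly K[6 + 6]}).
Local Notation T := (tangency_mx (gamma_vars K) (delta_vars K)).

Lemma bieval_tangency_mx p i j :
  bieval (T i j) p = tangency_mx p.1 p.2 i j.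
Proof.
rewrite /bieval; set v := fun i => _.
have mg : map_mx (meval v) (gamma_vars K) = p.1.
  by apply/colP => k; rewrite !mxE mevalXU /v col_mxEu.
have md : map_mx (meval v) (delta_vars K) = p.2.
  by apply/colP => k; rewrite !mxE mevalXU /v col_mxEd.
by rewrite -[in RHS]mg -[in RHS]md -map_tangency_mx [RHS]mxE.
Qed.

Lemma bieval_minor2 p s :
  bieval (minor2 T s) p = minor2 (tangency_mx p.1 p.2) s.
Proof.
by rewrite !minor2E /bieval mevalB !mevalM -!/(bieval _ _) !bieval_tangency_mx.
Qed.

Lemma bieval_ideal_generated p f :
  (\rank (tangency_mx p.1 p.2) <= 1)%N -> ideal_generated (minor2 T) f ->
  bieval f p = 0.
Proof.
move=> /rank_le1P M0 [a ->]; rewrite /bieval raddf_sum big1 // => s _.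
by rewrite /= mevalM -!/(bieval _ _) bieval_minor2 M0 mulr0.
Qed.

(** Pulling delta back along (u . x, s x0, s x1) multiplies its discriminant by
    (s u2)^2. *)
Lemma joint_image_rank p :
  joint_image (camera1 K) (camera2 K) p ->
  (\rank (tangency_mx p.1 p.2) <= 1)%N.
Proof.
move=> /joint_image_pullback [_ _ [k [s [u0 [u1 [u2 Ep]]]]]].
apply/rank_le1P => t; rewrite minor2E.
have E j :
    tangency_mx p.1 p.2 0 j = (k * s * u2) ^+ 2 * tangency_mx p.1 p.2 1 j.
  rewrite Ep /pullback; case: j => [[|[|[|//]]] hj];
    by rewrite !mxE /= ?mxE /=; ring.
by rewrite !E; ring.
Qed.

End Evaluation.

Lemma vanishing_ideal_generated (K : numClosedFieldType)
    (f : {mpoly K[6 + 6]}) :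
  (forall p, joint_image (camera1 K) (camera2 K) p -> bieval f p = 0) ->
  ideal_generated (minor2 (tangency_mx (gamma_vars K) (delta_vars K))) f.
Proof.
set T := tangency_mx _ _ => f0; apply: in_minors_ideal_generated.
have Ea1 : T 0 0 = qgamma11 K by rewrite !mxE.
have Eb1 : T 0 1 = qgamma01 K by rewrite !mxE.
have Ec1 : T 0 2 = qgamma00 K by rewrite !mxE.
have Ea2 : T 1 0 = qdelta11 K by rewrite !mxE.
have Eb2 : T 1 1 = qdelta01 K by rewrite !mxE.
have Ec2 : T 1 2 = qdelta00 K by rewrite !mxE.
rewrite Ea1 Eb1 Ec1 Ea2 Eb2 Ec2; apply: vanishing_in_minors => w r.
pose p : 'cV[K]_6 * 'cV[K]_6 :=
  (\col_i w (lshift 6 i), \col_i w (rshift 6 i)).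
have wE q : q.@[w] = bieval q p.
  apply: meval_eq => i; case: (split_ordP i) => k ->.
    by rewrite col_mxEu mxE.
  by rewrite col_mxEd mxE.
rewrite -Ea1 -Eb1 -Ec1 -Ea2 -Eb2 -Ec2 !wE !bieval_tangency_mx => g5 d0 r0.
move=> Ea Eb Ec; apply: f0; apply: (discriminant_joint_image (r := r)) => //.
- by rewrite mxE.
- by rewrite mxE.
- by move: Ea; rewrite [LHS]mxE [tangency_mx _ _ 1 _]mxE.
- by move: Eb; rewrite [LHS]mxE [tangency_mx _ _ 1 _]mxE.
- by move: Ec; rewrite [LHS]mxE [tangency_mx _ _ 1 _]mxE.
Qed.

Section Closure.
Local Open Scope classical_set_scope.
Variable K : numClosedFieldType.
Local Notation J := (joint_image (camera1 K) (camera2 K)).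
Local Notation V := (conic_multiview (camera1 K) (camera2 K)).
Local Notation T := (tangency_mx (gamma_vars K) (delta_vars K)).

Lemma joint_image_sub : J `<=` V.
Proof. by move=> p Jp Z _ /(_ p Jp). Qed.

Lemma conic_multiview_rank p : V p -> (\rank (tangency_mx p.1 p.2) <= 1)%N.
Proof.
pose F := [set minor2 T s | s in [set: {ffun 'I_2 -> 'I_3}]].
move=> /(_ (zero_locus F)) [||_ _ F0].
- by exists F => // _ [s _ <-]; exact: bihomogeneous_minor2.
- move=> q Jq; have [q1 q2 _] := joint_image_pullback Jq; split=> // _ [s _ <-].
  by rewrite bieval_minor2; apply/rank_le1P/joint_image_rank.
- by apply/rank_le1P => s; rewrite -bieval_minor2; apply: F0; exists s.
Qed.

Lemma rank_conic_multiview p : p.1 != 0 -> p.2 != 0 ->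
  (\rank (tangency_mx p.1 p.2) <= 1)%N -> V p.
Proof.
move=> p1 p2 rk _ [F _ ->] JF; split=> // f Ff.
apply: bieval_ideal_generated rk _; apply: vanishing_ideal_generated => q /JF.
by case=> _ _; apply.
Qed.

Lemma conic_multiviewP (gamma delta : 'cV[K]_6) :
  gamma != 0 -> delta != 0 ->
  V (gamma, delta) <-> (\rank (tangency_mx gamma delta) <= 1)%N.
Proof.
move=> g0 d0; split; first exact (@conic_multiview_rank (gamma, delta)).
exact (@rank_conic_multiview (gamma, delta) g0 d0).
Qed.

Lemma defining_ideal_conic_multiview :
  ideal_generated (minor2 T) = defining_ideal V.
Proof.
apply/seteqP; split=> f fI.
  by move=> p /conic_multiview_rank rk; exact: bieval_ideal_generated rk fI.
by apply: vanishing_ideal_generated => p /joint_image_sub; exact: fI.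
Qed.
End Closure.

Theorem theorem1 (R : realType) :
  (forall gamma delta : 'cV[R[i]]_6, gamma != 0 -> delta != 0 ->
     (conic_multiview (camera1 R[i]) (camera2 R[i]) (gamma, delta) <->
      (\rank (tangency_mx gamma delta) <= 1)%N)) /\
  ideal_generated
    (minor2 (tangency_mx (gamma_vars R[i]) (delta_vars R[i])))
  = defining_ideal (conic_multiview (camera1 R[i]) (camera2 R[i])).
Proof.
split; first exact (@conic_multiviewP R[i]).
exact (@defining_ideal_conic_multiview R[i]).
Qed.
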